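(* Let $n$ be a positive integer and $K$ a field whose characteristic does not divide $n$; let $\zeta_n$ be a primitive $n$-th root of unity in an algebraic closure of $K$. Let $L=K(\alpha_1,\dots,\alpha_k)$ be a finite Galois extension of $K$ with Galois group $G$. The following are equivalent: (1) $\zeta_n\in K$, $\alpha_i^n\in K$ for all $1\le i\le k$, and $n$ is the smallest positive integer $m$ with $\alpha_i^m\in K$ for all $i$. (2) $\{\alpha_1,\dots,\alpha_k\}$ is a set of $G$-eigenvectors (generating $L/K$) and the exponent of $G$ is $n$.
   Context: A nonzero element $\alpha$ of a Galois extension $L/K$ with group $G$ is a $G$-eigenvector if for every $\sigma\in G$ there is $\lambda_\sigma\in K$ with $\sigma(\alpha)=\lambda_\sigma\alpha$.
   Formalization: The generators α_1,…,α_k are assumed nonzero; without this (1)⇒(2) fails, e.g. for L=K, k=1, α_1=0, n=1, since G-eigenvectors are nonzero by definition. *)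

(* Defs.v *)
From mathcomp Require Import all_boot all_order all_fingroup all_algebra.
From mathcomp Require Import all_solvable all_field.

Set Implicit Arguments.
Unset Strict Implicit.
Unset Printing Implicit Defensive.

Import GRing.Theory.
Local Open Scope ring_scope.

(* The base field K of L is identified with its image 1%VS = K.1 in L, so an  *)
(* element lambda of K acts on L by scaling.                                  *)
Definition Geigenvector (K : fieldType) (L : splittingFieldType K) (a : L) :
    Prop :=
  a != 0 /\
  forall sigma : gal_of {:L}, sigma \in 'Gal({:L} / 1)%g ->
    exists lambda : K, sigma a = lambda *: a.

Definition algebraic_closure (K : fieldType) (Kbar : closedFieldType)
    (iota : {rmorphism K -> Kbar}) : Prop :=
  forall x : Kbar, algebraicOver iota x.

(* Main.v *)
Require Import Defs.
From mathcomp Require Import all_boot all_order all_fingroup all_algebra.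
From mathcomp Require Import all_solvable all_field.

Set Implicit Arguments.
Unset Strict Implicit.
Unset Printing Implicit Defensive.

Import GRing.Theory.
Local Open Scope ring_scope.

(* If sigma(alpha_i) = lambda_(sigma,i) alpha_i with lambda_(sigma,i) in K,   *)
(* then alpha_i^m lies in K for all i iff every lambda_(sigma,i)^m is 1, iff  *)
(* every sigma^m fixes the generators alpha_i, iff the exponent of G divides  *)
(* m. If zeta_n and alpha_i^n lie in K, then sigma(alpha_i) / alpha_i is an   *)
(* n-th root of unity, so lies in K. Conversely, let the exponent be n: by    *)
(* Bezout the lambda_(sigma,i), which are powers of zeta_n, put some zeta_n^d *)
(* in K with d | n and d dividing all their exponents; then all the           *)
(* lambda_(sigma,i)^(n/d) are 1, so n divides n/d, whence d = 1.              *)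

(** For generating eigenvectors, [exponent_gal_eigen] identifies the least common exponent of the
    alpha_i modulo K with the exponent of G. What remains is to trade the eigenvector property for
    zeta_n in K: [prim_root_eigen] goes one way, and [prim_root_subfield], applied to all
    eigenvalues at once, goes the other. *)

Lemma scaler_injr (K : fieldType) (V : lmodType K) (v : V) :
  v != 0 -> injective (fun l : K => l *: v).
Proof.
move=> v_neq0 l l' /eqP.
by rewrite -subr_eq0 -scalerBl scaler_eq0 (negPf v_neq0) orbF subr_eq0 => /eqP.
Qed.

Section Eigenvectors.

Variables (K : fieldType) (L : splittingFieldType K).
Implicit Types (a : L) (s : gal_of {:L}).

Lemma galX_eigen s a (l : K) m :
  s a = l *: a -> (s ^+ m)%g a = l ^+ m *: a.
Proof.
move=> sa; elim: m => [|m IHm]; first by rewrite expg0 gal_id scale1r.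
by rewrite expgSr galM ?memvf // IHm linearZ /= sa scalerA -exprSr.
Qed.

Lemma gal_eq1_gen (rs : seq L) s :
  <<1 & rs>>%VS = {:L}%VS -> {in rs, forall a, s a = a} -> s = 1%g.
Proof.
move=> genL fix_s; apply/eqP/gal_eqP => a _; rewrite gal_id.
have /subvP/(_ a): (<<1 & rs>> <= fixedField [set s])%VS.
  apply/Fadjoin_seqP; split=> [|b rs_b]; first exact: sub1v.
  by apply/fixedFieldP=> [|_ /set1P->]; [apply: memvf | apply: fix_s].
rewrite genL => /(_ (memvf a))/mem_fixedFieldP[_]; apply.
exact: set11.
Qed.

Lemma mem1_galoisP a :
  galois 1 {:L} ->
  (forall s, s \in 'Gal({:L} / 1)%g -> s a = a) <-> a \in 1%VS.
Proof.
move=> galL; split=> [fix_a | a1 s Gs]; last exact: (fixed_gal (subvf _) Gs).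
by rewrite -(galois_fixedField galL); apply/fixedFieldP; rewrite ?memvf.
Qed.

(** If [s a = l *: a], then [s] multiplies [a ^+ m] by [l ^+ m]; since [a ^+ m] is nonzero, it is
    fixed exactly when that factor is 1. *)
Lemma eigen_expr_mem1 a m :
  galois 1 {:L} -> Geigenvector a ->
  (forall s (l : K), s \in 'Gal({:L} / 1)%g -> s a = l *: a -> l ^+ m = 1)
  <-> a ^+ m \in 1%VS.
Proof.
move=> galL [a_neq0 eig_a]; have am_neq0: a ^+ m != 0 by rewrite expf_neq0.
split=> [l1 | am1 s l Gs sa].
  apply/(mem1_galoisP _ galL) => s Gs; have [l sa] := eig_a s Gs.
  by rewrite rmorphXn /= sa exprZn (l1 s l) ?scale1r.
have /(mem1_galoisP _ galL)/(_ s Gs) := am1; rewrite rmorphXn /= sa exprZn.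
by rewrite -[RHS]scale1r => /(scaler_injr am_neq0).
Qed.

(** [s ^+ m] acts on each generator by the m-th power of the eigenvalue of [s], and an automorphism
    fixing the generators is trivial. *)
Lemma exponent_gal_eigen k (alpha : k.-tuple L) m :
  galois 1 {:L} -> <<1 & alpha>>%VS = {:L}%VS ->
  (forall i, Geigenvector (tnth alpha i)) ->
  (forall i, tnth alpha i ^+ m \in 1%VS)
  <-> (exponent 'Gal({:L} / 1)%g %| m)%N.
Proof.
move=> galL genL eig; split=> [am1 | /exponentP expG i].
  apply/exponentP=> s Gs; apply: (gal_eq1_gen genL) => _ /tnthP[i ->].
  have [_ /(_ s Gs)[l sa]] := eig i.
  have /(eigen_expr_mem1 m galL (eig i))/(_ s l Gs sa) lm1 := am1 i.
  by rewrite (galX_eigen m sa) lm1 scale1r.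
apply/(eigen_expr_mem1 m galL (eig i)) => s l Gs sa.
have [a_neq0 _] := eig i; have := galX_eigen m sa.
by rewrite expG // gal_id -[LHS]scale1r => /(scaler_injr a_neq0).
Qed.

Lemma prim_root_eigen n (z : K) a :
  galois 1 {:L} -> n.-primitive_root z -> a != 0 -> a ^+ n \in 1%VS ->
  Geigenvector a.
Proof.
move=> galL prim_z a_neq0 an1; split=> // s Gs.
have prim_zA: n.-primitive_root (in_alg L z) by rewrite fmorph_primitive_root.
have /(prim_rootP prim_zA)[i sa]: (s a / a) ^+ n = 1.
  rewrite expr_div_n -rmorphXn /=.
  have /(mem1_galoisP _ galL)/(_ s Gs)-> := an1.
  by rewrite divff ?expf_neq0.
exists (z ^+ i); apply: (divIf a_neq0).
by rewrite sa -rmorphXn /= -scalerAl divff.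
Qed.

End Eigenvectors.

(** The images of [xs] generate a subgroup of the cyclic group of [zeta]; a generator [zeta ^+ d] of
    it is a product of powers of elements of [iota K], hence lies in [iota K]. *)
Lemma prim_root_subfield (K F : fieldType) (iota : {rmorphism K -> F}) n
    (zeta : F) (xs : seq K) :
  n.-primitive_root zeta -> {in xs, forall x, x ^+ n = 1} ->
  exists d z, [/\ (d %| n)%N, iota z = zeta ^+ d
                & {in xs, forall x, x ^+ (n %/ d) = 1}].
Proof.
move=> prim_zeta; have n_gt0 := prim_order_gt0 prim_zeta.
elim: xs => [|x xs IHxs] xs1.
  by exists n, 1; rewrite rmorph1 (prim_expr_order prim_zeta).
have [y xs_y|d [z [d_n iz xsd]]] := IHxs.
  by apply: xs1; rewrite inE xs_y orbT.
have /(prim_rootP prim_zeta)[e ix]: iota x ^+ n = 1.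
  by rewrite -rmorphXn xs1 ?mem_head ?rmorph1.
have d_gt0 := dvdn_gt0 n_gt0 d_n.
have [u _ /dvdnP[v Buv]] := Bezoutl e d_gt0.
have g_d := dvdn_gcdl d e; have g_n := dvdn_trans g_d d_n.
have zeta_neq0 : zeta != 0 by rewrite (prim_root_eq0 prim_zeta) -lt0n.
(* Bezout gives gcd(d, e) + u e = v d, so this quotient maps to [zeta] to the power d v - e u =
   gcd(d, e). *)
exists (gcdn d e), (z ^+ v / x ^+ u); split=> // [|y].
  rewrite fmorph_div !rmorphXn /= iz ix -!exprM [(d * v)%N]mulnC -Buv.
  by rewrite [(e * u)%N]mulnC exprD mulfK ?expf_neq0.
rewrite inE => /predU1P[->|/xsd yd1].
  apply: (fmorph_inj iota); rewrite rmorph1 rmorphXn /= ix -exprM.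
  apply/eqP; rewrite -(prim_order_dvd prim_zeta) -{1}(divnK g_n) mulnC.
  by rewrite dvdn_mul ?dvdn_gcdr.
by rewrite -[X in (X %/ _)%N](divnK d_n) -muln_divA // exprM yd1 expr1n.
Qed.

Theorem theorem4p7 (n : nat) (K : fieldType) (n_gt0 : (0 < n)%N)
    (charK : forall p : nat, p \in [pchar K] -> ~~ (p %| n)%N)
    (Kbar : closedFieldType) (iota : {rmorphism K -> Kbar})
    (Kbar_closure : algebraic_closure iota)
    (zeta : Kbar) (zeta_prim : n.-primitive_root zeta)
    (L : splittingFieldType K) (galL : galois 1 {:L})
    (k : nat) (alpha : k.-tuple L)
    (alpha_neq0 : forall i : 'I_k, tnth alpha i != 0)
    (genL : <<1 & alpha>>%VS = {:L}%VS) :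
  [/\ exists z : K, iota z = zeta,
      forall i : 'I_k, tnth alpha i ^+ n \in 1%VS
    & forall m : nat, (0 < m)%N ->
        (forall i : 'I_k, tnth alpha i ^+ m \in 1%VS) -> (n <= m)%N]
  <->
  [/\ forall i : 'I_k, Geigenvector (tnth alpha i),
      <<1 & alpha>>%VS = {:L}%VS
    & exponent 'Gal({:L} / 1)%g = n].
Proof.
split=> [[[z iz] an1 min_n] | [eig _ expG]].
  have prim_z: n.-primitive_root z by rewrite -(fmorph_primitive_root iota) iz.
  have eig i: Geigenvector (tnth alpha i).
    exact: (prim_root_eigen galL prim_z).
  have expP m := exponent_gal_eigen m galL genL eig.
  split=> //; apply/eqP; rewrite eqn_leq dvdn_leq //=; last exact/expP.
  by rewrite min_n ?exponent_gt0 //; apply/expP.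
have expP m := exponent_gal_eigen m galL genL eig; rewrite expG in expP.
have an1: forall i, tnth alpha i ^+ n \in 1%VS by apply/expP.
split=> //; last by move=> m m_gt0 /expP/dvdn_leq->.
pose P (p : gal_of {:L} * 'I_k) (l : K) :=
  p.1 \in 'Gal({:L} / 1)%g -> p.1 (tnth alpha p.2) = l *: tnth alpha p.2.
have /fin_all_exists[l lP]: forall p, exists l, P p l.
  move=> [s i]; have [Gs | notGs] := boolP (s \in 'Gal({:L} / 1)%g).
    by have [_ /(_ s Gs)[l sa]] := eig i; exists l.
  (* Outside the group [P] is vacuous, so 1 is a dummy value. *)
  by exists 1; rewrite /P /= (negPf notGs).
pose ls := [seq l p | p in [pred p | p.1 \in 'Gal({:L} / 1)%g]].
have [_ /imageP[[s i] Gs ->]|d [z [d_n iz lsd]]] :=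
    prim_root_subfield (xs := ls) iota zeta_prim.
  have /(eigen_expr_mem1 n galL (eig i)) := an1 i; apply; first exact: Gs.
  exact: lP (s, i) Gs.
(* All eigenvalues are killed by n/d, so the exponent n divides n/d. This forces d = 1, and then [z]
   maps to [zeta] itself. *)
have /expP n_nd: forall i, tnth alpha i ^+ (n %/ d) \in 1%VS.
  move=> i; apply/(eigen_expr_mem1 _ galL (eig i)) => s x Gs sx.
  have [a_neq0 _] := eig i; have := lP (s, i) Gs.
  rewrite /= sx => /(scaler_injr a_neq0)->.
  by apply/lsd/imageP; exists (s, i).
have d_gt0 := dvdn_gt0 n_gt0 d_n.
have /(dvdn_leq _)/= := n_nd; rewrite divn_gt0 // dvdn_leq // => /(_ isT).
case: d d_gt0 {d_n n_nd lsd} iz => [//|[|d]] _ iz; first by exists z.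
by rewrite leqNgt ltn_Pdiv.
Qed.
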